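(* Let $(X,\rho)$ be a complete metric space and let $\mathcal{K}\subset C(\mathbb{R}^+,X)$ satisfy (K1)–(K4) (listed in the context). Let $\varphi\in\mathcal{K}$ be such that the closure of its positive orbit $\bigcup_{t\ge0}\{\varphi(t)\}$ is compact. Let $\mathbb{K}_\varphi$ be a set of bounded complete trajectories of $\mathcal{K}$ such that $\omega(\varphi)=\{\phi(0):\phi\in\mathbb{K}_\varphi\}$ (such a set exists because $\omega(\varphi)$ is quasi-invariant), and put $\Omega_\varphi=\bigcup_{\phi\in\mathbb{K}_\varphi}\omega(\phi)$. Let $\Omega_\varphi\subset M=\bigcup_{j=1}^m M_j$, $m\ge1$, where $M_j\subset\omega(\varphi)$ are compact, pairwise disjoint, isolated, quasi-invariant subsets. Then either $\omega(\varphi)=M_1$ (so $m=1$) or there exists a cyclical chain $\{\widetilde M_1,\dots,\widetilde M_k\}$, $1\le k\le m$, where each $\widetilde M_i$ is equal to some $M_j$. Moreover, the connections in this chain belong entirely to $\omega(\varphi)$ (i.e. the connecting complete trajectories take all their values in $\omega(\varphi)$).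
   Context: $\mathbb{R}^+=[0,\infty)$. Conditions on $\mathcal{K}\subset C(\mathbb{R}^+,X)$: (K1) for every $x\in X$ there is $\varphi\in\mathcal{K}$ with $\varphi(0)=x$; (K2) if $\varphi\in\mathcal{K}$ and $\tau\ge 0$, then $\varphi(\cdot+\tau)\in\mathcal{K}$; (K3) if $\varphi_1,\varphi_2\in\mathcal{K}$ and $\varphi_2(0)=\varphi_1(s)$ with $s>0$, then the function equal to $\varphi_1(t)$ for $t\le s$ and to $\varphi_2(t-s)$ for $t>s$ belongs to $\mathcal{K}$; (K4) if $\varphi_n\in\mathcal{K}$ and $\varphi_n(0)\to x_0\in X$, then there are a subsequence and $\varphi_0\in\mathcal{K}$ with $\varphi_{n_k}(t)\to\varphi_0(t)$ uniformly on compact subsets of $[0,\infty)$. A map $\phi:\mathbb{R}\to X$ is a complete trajectory of $\mathcal{K}$ if $\phi(\cdot+h)|_{[0,\infty)}\in\mathcal{K}$ for all $h\in\mathbb{R}$; it is bounded if $\phi(\mathbb{R})$ is bounded. A set $A\subset X$ is quasi-invariant if for each $x\in A$ there is at least one complete trajectory $\phi$ of $\mathcal{K}$ with $\phi(0)=x$ and $\phi(t)\in A$ for all $t\in\mathbb{R}$. A quasi-invariant set $M$ is isolated if there is a neighborhood $O$ of $M$ such that $M$ is the maximal quasi-invariant set in $O$. For $\varphi\in\mathcal{K}$, or for a complete trajectory, $\omega(\varphi)=\{y\in X:\exists\,t_n\to+\infty\text{ with }\varphi(t_n)\to y\}$; for a complete trajectory $\phi$, $\alpha(\phi)=\{y\in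 X:\exists\,t_n\to-\infty\text{ with }\phi(t_n)\to y\}$. Under (K1)–(K4), if the closure of the positive orbit of $\varphi\in\mathcal{K}$ is compact, then $\omega(\varphi)$ is non-empty, compact, connected and quasi-invariant. There is a connection from a set $M$ to a set $N$ if there are $x\notin M\cup N$ and a bounded complete trajectory $\phi$ of $\mathcal{K}$ with $\phi(0)=x$, $\varnothing\ne\omega(\phi)\subset N$ and $\varnothing\ne\alpha(\phi)\subset M$. A finite family of pairwise disjoint sets $\{M_1,\dots,M_k\}$, $k\ge1$, is a cyclical chain if for each $j\in\{1,\dots,k\}$ there is a connection from $M_j$ to $M_{j+1}$, where $M_{k+1}=M_1$ (when $k=1$, there is a connection from $M_1$ to itself).
   Formalization: The trajectories in K_φ are assumed to take all their values in ω(φ), not only their values at 0 (otherwise connections inside ω(φ) may fail to exist), and the sets M_j are assumed nonempty. *)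

(* Defs.v *)
From HB Require Import structures.
From mathcomp Require Import all_boot all_order all_algebra.
From mathcomp Require Import all_classical all_reals all_analysis.

Set Implicit Arguments.
Unset Strict Implicit.
Unset Printing Implicit Defensive.

Import Order.TTheory GRing.Theory Num.Theory.
Import numFieldNormedType.Exports.

Local Open Scope classical_set_scope.
Local Open Scope ring_scope.

(* The library's [Complete] is pointed, so these spaces are nonempty. *)
#[short(type="completeMetricType")]
HB.structure Definition CompleteMetric (R : numDomainType) :=
  {T of Complete T & Metric R T}.

(* Used as a type, [Rplus R] carries the topology induced by [R]. *)
Definition Rplus (R : realType) : set R := [set t | 0 <= t].
Arguments Rplus R : clear implicits.

Lemma Rplus_max (R : realType) (t : R) : Num.max 0 t \in Rplus R.
Proof. by apply/mem_set; rewrite /Rplus /= le_max lexx. Qed.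

(* Inverse of [\val : Rplus R -> R]; it is only applied to nonnegative reals
   below, so that the truncation at 0 of the others is irrelevant. *)
Definition to_Rplus (R : realType) (t : R) : Rplus R := SigSub (Rplus_max t).

Section Trajectories.
Context {R : realType} {X : metricType R}.
Implicit Types (K : set (Rplus R -> X)) (f : Rplus R -> X) (g : R -> X).
Implicit Types A M N : set X.

Definition condK1 K := forall x, exists2 f, K f & f (to_Rplus 0) = x.

Definition condK2 K := forall f (tau : R), K f -> 0 <= tau ->
  K (fun t => f (to_Rplus (\val t + tau))).

Definition condK3 K := forall f1 f2 (s : R), K f1 -> K f2 -> 0 < s ->
  f2 (to_Rplus 0) = f1 (to_Rplus s) ->
  K (fun t => if \val t <= s then f1 t else f2 (to_Rplus (\val t - s))).

Definition condK4 K := forall (f_ : nat -> Rplus R -> X) (x0 : X),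
  (forall n, K (f_ n)) -> f_ n (to_Rplus 0) @[n --> \oo] --> x0 ->
  exists (sub : nat -> nat) (f0 : Rplus R -> X),
    [/\ {homo sub : i j / (i < j)%N}, K f0 &
        {family compact, f_ (sub k) @[k --> \oo] --> f0}].

Definition complete_trajectory K g :=
  forall h : R, K (sigL (Rplus R) (fun t => g (t + h))).

Definition mbounded A := exists B : R, forall x y, A x -> A y -> mdist x y <= B.

Definition bounded_complete_trajectory K g :=
  complete_trajectory K g /\ mbounded (range g).

Definition quasi_invariant K A := forall x, A x ->
  exists g, [/\ complete_trajectory K g, g 0 = x & forall t, A (g t)].

(* "Maximal" means largest for inclusion. *)
Definition isolated_qi K M := exists O : set X,
  [/\ set_nbhs M O, quasi_invariant K M, M `<=` O &
      forall A, quasi_invariant K A -> A `<=` O -> A `<=` M].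

Definition omega_Rplus f : set X := [set y | exists t : nat -> Rplus R,
  \val (t n) @[n --> \oo] --> +oo /\ f (t n) @[n --> \oo] --> y].

Definition omega g : set X := [set y | exists t : nat -> R,
  t n @[n --> \oo] --> +oo /\ g (t n) @[n --> \oo] --> y].

Definition alpha g : set X := [set y | exists t : nat -> R,
  t n @[n --> \oo] --> -oo /\ g (t n) @[n --> \oo] --> y].

Definition connecting_trajectory K M N g :=
  [/\ bounded_complete_trajectory K g, ~ (M `|` N) (g 0),
      omega g !=set0 /\ omega g `<=` N & alpha g !=set0 /\ alpha g `<=` M].

Definition connection K M N := exists g, connecting_trajectory K M N g.

(* [ordS] is the cyclic successor, so the last set is connected to the first. *)
Definition cyclical_chain K (k : nat) (C : 'I_k -> set X) :=
  [/\ (0 < k)%N, trivIset setT C & forall j, connection K (C j) (C (ordS j))].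

End Trajectories.

(* Main.v *)
(* Following connections M_j -> M_l through the finite family eventually closes
   up a cycle, so it suffices to find one connection out of every M_j unless the
   omega-limit set W of phi equals M_j.  If W is not M_j, then phi comes
   arbitrarily close to M_j and leaves a neighbourhood of it infinitely often; a
   limit of the translates of phi to the exit times gives a complete trajectory
   in W whose alpha-limit set lies in M_j by isolation, and which at time 0 lies
   at a small positive distance from M_j, hence outside all the M_i.  Its future
   is replaced by a member of KK, whose omega-limit set lies in the union of the
   M_i, and in fact in a single M_l: passing infinitely often from M_l to another
   M_i would force accumulation at a fixed small distance from M_l. *)

Require Import Defs.
From mathcomp Require Import all_boot all_order all_algebra.
From mathcomp Require Import all_classical all_reals all_analysis.
From mathcomp Require Import lra zify.
Set Implicit Arguments.
Unset Strict Implicit.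
Unset Printing Implicit Defensive.

Import Order.TTheory GRing.Theory Num.Theory.
Import numFieldNormedType.Exports.
Local Open Scope classical_set_scope.
Local Open Scope ring_scope.

(** * Level crossings and subsequence indices *)

(** The times in [[a, b]] where [f] is at least [e] form a nonempty compact set, and [c] is its
    least element. *)
Lemma first_crossing (R : realType) (f : R -> R) (a b e : R) :
  continuous f -> a <= b -> f a <= e -> e <= f b ->
  exists c, [/\ a <= c, c <= b, f c = e & forall t, a <= t -> t <= c -> f t <= e].
Proof.
move=> cf ab fa fb.
pose A : set R := `[a, b] `&` f @^-1` [set y | e <= y].
have cA : compact A.
  apply: compact_closedI; first exact: segment_compact.
  by move/continuous_closedP: cf; apply; exact: closed_ge.
have A0 : A !=set0 by exists b; split => //=; rewrite in_itv/= ab lexx.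
have [|c cA' cmin] := @compact_EVT_min _ R id A A0 cA.
  by apply: continuous_subspaceT => x; exact: cvg_id.
move: cA'; rewrite inE => -[/=]; rewrite in_itv/= => /andP[ac cb] efc.
have lt_e t : a <= t -> t < c -> f t < e.
  move=> at_ tc; rewrite ltNge; apply/negP => eft.
  have := cmin t; rewrite inE leNgt tc => /(_ _) /negP; apply => //.
  by split => //=; rewrite in_itv/= at_ (le_trans (ltW tc)).
(* The intermediate value theorem gives a time in [[a, c]] at level [e]; minimality of [c] forbids
   it to be earlier than [c]. *)
have fce : f c = e.
  have [|d] := @IVT _ f a c e ac (continuous_subspaceT cf).
    by rewrite ge_min fa le_max efc orbT.
  rewrite in_itv/= => /andP[ad dc] fd.
  move: dc; rewrite le_eqVlt => /orP[/eqP <-//|dc].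
  by have := lt_e _ ad dc; rewrite fd ltxx.
exists c; split => // t at_; rewrite le_eqVlt => /orP[/eqP ->|/lt_e/ltW]; last exact.
by rewrite fce.
Qed.

Lemma homo_geq_id {s : nat -> nat} :
  {homo s : i j / (i < j)%N} -> forall n, (n <= s n)%N.
Proof. by move=> hs; elim=> // n /leq_ltn_trans; apply; exact: hs. Qed.

Lemma invS_lt (R : realType) (e : R) : 0 < e ->
  exists N, forall n, (N <= n)%N -> n.+1%:R^-1 < e.
Proof.
move=> e0; exists (Num.truncn e^-1) => n Nn.
rewrite -[ltRHS]invrK ltf_pV2 ?posrE ?invr_gt0 ?ltr0n//.
by rewrite (lt_le_trans (Num.Theory.truncnS_gt _))// ler_nat.
Qed.

(** * Distance to a compact set *)

Section MetricSpace.
Context {R : realType} {X : metricType R}.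
Implicit Types (A C U : set X) (x y : X) (u : nat -> X).

Lemma cvg_mdistP u x : u n @[n --> \oo] --> x <->
  forall e : R, 0 < e -> exists N, forall n, (N <= n)%N -> mdist x (u n) < e.
Proof.
split.
  move=> /metricType_numDomainType.cvgrPdist_lt + e e0 => /(_ e e0)[N _ NP].
  by exists N => n; exact: NP.
move=> h; apply/metricType_numDomainType.cvgrPdist_lt => e /h [N NP].
by exists N => // n /=; exact: NP.
Qed.

(** Compactness gives a cluster point [x]; [f (k, N)] is an index at least [N] whose term is within
    [1/(k+1)] of [x], and feeding in the successor of the previous index makes the choice
    increasing. *)
Lemma compact_subseq C u : compact C -> (forall n, C (u n)) ->
  exists s x, [/\ {homo s : i j / (i < j)%N}, C x & u (s n) @[n --> \oo] --> x].
Proof.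
move=> cC Cu.
have [|x [Cx xu]] := cC (u @ \oo) _; first by exists 0%N => // n _; exact: Cu.
have /choice[f fP] : forall kN : nat * nat,
    exists n, (kN.2 <= n)%N /\ mdist x (u n) < kN.1.+1%:R^-1.
  move=> [k N]/=.
  have [||y [[n /= Nn <-]]] := xu (u @` [set n | (N <= n)%N]) (ball x k.+1%:R^-1).
  - by exists N => // n /= Nn; exists n.
  - by apply: nbhsx_ballx; rewrite invr_gt0 ltr0n.
  - by rewrite ballEmdist /= => ?; exists n.
pose s := fix s k := if k is k'.+1 then f (k, (s k').+1) else f (0, 0)%N.
have sP k : mdist x (u (s k)) < k.+1%:R^-1.
  by case: k => [|k] /=; [have [] := fP (0, 0)%N | have [] := fP (k.+1, (s k).+1)].
exists s, x; split => //.
  apply: homo_ltn; first exact: ltn_trans.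
  by move=> n /=; have [] := fP (n.+1, (s n).+1).
apply/cvg_mdistP => e /invS_lt [N NP]; exists N => n /NP.
by apply: lt_trans; exact: sP.
Qed.

(** For empty [A] this is the default value 0 of [inf], so a small value means closeness to [A] only
    when [A] is nonempty. *)
Definition dist_to A x := inf [set mdist x a | a in A].

Lemma dist_to_lb A x : has_lbound [set mdist x a | a in A].
Proof. by exists 0 => _ [a _ <-]; exact: mdist_ge0. Qed.

Lemma dist_to_le A x a : A a -> dist_to A x <= mdist x a.
Proof. by move=> Aa; apply: ge_inf; [exact: dist_to_lb | exists a]. Qed.

Lemma dist_to_ge0 A x : A !=set0 -> 0 <= dist_to A x.
Proof.
move=> [a Aa]; apply: lb_le_inf; first by exists (mdist x a), a.
by move=> _ [b _ <-]; exact: mdist_ge0.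
Qed.

Lemma dist_to_lt A x e : A !=set0 -> dist_to A x < e ->
  exists2 a, A a & mdist x a < e.
Proof.
move=> [a Aa] /inf_lt[|_ [b Ab <-] ?]; last by exists b.
by exists (mdist x a), a.
Qed.

Lemma dist_to0 A x : A x -> dist_to A x = 0.
Proof.
move=> Ax; apply/eqP; rewrite eq_le -{1}(mdistxx x) dist_to_le//=.
by apply: dist_to_ge0; exists x.
Qed.

Lemma dist_to_triangle A x y : A !=set0 ->
  dist_to A x <= mdist x y + dist_to A y.
Proof.
move=> A0; apply/ler_addgt0Pl => e e0.
have [|a Aa ya] := @dist_to_lt A y (dist_to A y + e) A0; first by lra.
by rewrite (le_trans (dist_to_le _ Aa))// (le_trans (metric_triangle _ y _))//; lra.
Qed.

Lemma dist_to_continuous A : A !=set0 -> continuous (dist_to A).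
Proof.
move=> A0 x; apply/cvgrPdist_lt => e e0.
have : \forall y \near x, mdist x y < e.
  by apply/metricType_numDomainType.nbhs_mdistP; exists e.
apply: filterS => y xy.
have := dist_to_triangle x y A0; have := dist_to_triangle y x A0.
rewrite (metric_sym y x) => *; rewrite ltr_norml; apply/andP; split; lra.
Qed.

Lemma cvg_dist_to_eq A u y e : A !=set0 -> u n @[n --> \oo] --> y ->
  (forall n, dist_to A (u n) = e) -> dist_to A y = e.
Proof.
move=> A0 uy ue; apply: (@cvg_unique _ (@Rhausdorff R) (dist_to A (u n) @[n --> \oo])).
  exact: (cvg_comp _ _ uy (dist_to_continuous A0 (x:=y))).
by rewrite (_ : (fun n => dist_to A (u n)) = cst e); [exact: cvg_cst | exact: funext].
Qed.

(** Otherwise points outside [U] come arbitrarily close to [A]; their near-projections subconverge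
    to some [a] in [A], and [U], a neighbourhood of [a], must contain some of them. *)
Lemma compact_nbhs_dist_to A U : compact A -> A !=set0 -> set_nbhs A U ->
  exists2 e, 0 < e & forall x, dist_to A x <= e -> U x.
Proof.
move=> cA A0 AU; apply: contrapT => hU.
(* The pair is a point outside [U] and a near-projection to [A]; doubling [1/(n+1)] gives room for
   an infimum that is only approached. *)
have /choice[v vP] : forall n : nat, exists xa : X * X,
    [/\ ~ U xa.1, A xa.2 & mdist xa.2 xa.1 < n.+1%:R^-1 *+ 2].
  move=> n; have n0 : 0 < n.+1%:R^-1 :> R by rewrite invr_gt0 ltr0n.
  apply: contrapT => hn; apply: hU; exists n.+1%:R^-1 => // x xn.
  apply: contrapT => Ux; apply: hn.
  have [|a Aa xa] := @dist_to_lt A x (n.+1%:R^-1 *+ 2) A0.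
    by rewrite (le_lt_trans xn)// mulr2n ltrDl.
  by exists (x, a); split => //=; rewrite metric_sym.
have [n|s [a [hs Aa sa]]] := @compact_subseq A (fun n => (v n).2) cA.
  by case: (vP n).
have /metricType_numDomainType.nbhs_mdistP[r /= r0 aU] := AU a Aa.
(* One third of [r] bounds the distance from [a] to the near-projection, two thirds the doubled
   inverse. *)
have r20 : 0 < r / 3 by lra.
have [N NP] := (cvg_mdistP _ _).1 sa _ r20.
have [N' N'P] := invS_lt r20.
pose n := maxn N N'.
have [+ _ _] := vP (s n); apply; apply: aU => /=.
rewrite (le_lt_trans (metric_triangle _ (v (s n)).2 _))//.
have := NP n (leq_maxl _ _).
have := N'P (s n) (leq_trans (leq_maxr _ _) (homo_geq_id hs n)).
have [_ _] := vP (s n); rewrite mulr2n.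
move: (_^-1) (mdist _ _) (mdist _ _) => i p q; lra.
Qed.

(** If [x] were outside [A], the complement of [x] would be a neighbourhood of [A] and so contain
    every point at distance 0, including [x]. *)
Lemma dist_to_eq0 A x : compact A -> A !=set0 -> dist_to A x = 0 -> A x.
Proof.
move=> cA A0 Ax0; apply: contrapT => Ax.
have [|e e0 h] := @compact_nbhs_dist_to A (~` [set x]) cA A0; last first.
  by apply: (h x) => //; rewrite Ax0 ltW.
move=> a Aa; apply: open_nbhs_nbhs; split; last by move=> /= ax; rewrite -ax in Ax.
apply: closed_openC; apply: compact_closed; first exact: metric_hausdorff.
exact: compact_set1.
Qed.

Lemma compact_mbounded C : compact C -> mbounded C.
Proof.
move=> cC; have [->|/set0P[x Cx]] := eqVneq C set0; first by exists 0.
have Cne : C !=set0 by exists x.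
have [|c _ cP] := @compact_EVT_max X R (dist_to [set x]) C Cne cC.
  by apply: continuous_subspaceT; apply: dist_to_continuous; exists x.
have dE y : dist_to [set x] y = mdist y x.
  by rewrite /dist_to image_set1 inf1.
exists (mdist c x *+ 2) => y z Cy Cz.
rewrite (le_trans (metric_triangle _ x _))// mulr2n lerD//.
  by have := cP y; rewrite inE !dE; exact.
by have := cP z; rewrite inE !dE metric_sym; exact.
Qed.

End MetricSpace.

(** * Trajectories, limits of translates and limit sets *)

Section HalfTrajectories.
Context {R : realType} {X : metricType R} (K : set (Rplus R -> X)).
Implicit Types (f g : R -> X).

(** Members of [K] are represented by functions on the whole line, with arbitrary values at negative
    times, so that time shifts become plain additions. *)
Definition half_trajectory f := K (sigL (Rplus R) f).

Lemma val_to_Rplus (t : R) : 0 <= t -> \val (to_Rplus t) = t.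
Proof. by move=> /= t0; rewrite max_r. Qed.

Lemma sigL_val f (t : Rplus R) : sigL (Rplus R) f t = f (\val t).
Proof. by []. Qed.

Lemma Rplus_ge0 (t : Rplus R) : 0 <= \val t.
Proof. exact: (set_mem (valP t)). Qed.

Lemma to_RplusK (t : Rplus R) : to_Rplus (\val t) = t.
Proof. by apply: val_inj; rewrite val_to_Rplus// Rplus_ge0. Qed.

Lemma half_trajectory_ext f g : (forall t : R, 0 <= t -> f t = g t) ->
  half_trajectory f -> half_trajectory g.
Proof.
move=> fg; rewrite /half_trajectory.
suff -> : sigL (Rplus R) f = sigL (Rplus R) g by [].
by apply/funext => t; apply: fg; exact: Rplus_ge0.
Qed.

Lemma sigL_to_Rplus (f : Rplus R -> X) : sigL (Rplus R) (f \o @to_Rplus R) = f.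
Proof. by apply/funext => t; rewrite sigL_val/= to_RplusK. Qed.

Lemma half_trajectory_shift f (tau : R) : condK2 K -> 0 <= tau ->
  half_trajectory f -> half_trajectory (fun t => f (t + tau)).
Proof.
move=> K2 tau0 /K2 /(_ tau0); rewrite /half_trajectory.
set a := (X in K X -> _); set b := (X in _ -> K X); suff -> : a = b by [].
apply/funext => t; rewrite /a /b !sigL_val val_to_Rplus//.
by rewrite addr_ge0//; exact: Rplus_ge0.
Qed.

Lemma half_trajectory_concat f g (s : R) : condK3 K -> 0 < s -> g 0 = f s ->
  half_trajectory f -> half_trajectory g ->
  half_trajectory (fun t => if t <= s then f t else g (t - s)).
Proof.
move=> K3 s0 gf Kf Kg; have := K3 _ _ s Kf Kg s0; rewrite /half_trajectory.
rewrite !sigL_val !val_to_Rplus// ?ltW// => /(_ gf).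
set a := (X in K X -> _); set b := (X in _ -> K X); suff -> : a = b by [].
apply/funext => t; rewrite /a /b !sigL_val; case: ifPn => // ts.
by rewrite val_to_Rplus// subr_ge0 ltW// ltNge.
Qed.

Lemma to_Rplus_continuous : continuous (@to_Rplus R).
Proof.
apply: continuous_comp_initial => x /=.
apply: (@continuous_max R R (cst 0) id); [exact: cst_continuous | exact: cvg_id].
Qed.

(** This is (K4) in epsilon form; the compact sets used are the images of the segments [[0, a]]
    under [to_Rplus]. *)
Lemma half_trajectory_limit (u : nat -> R -> X) (x0 : X) : condK4 K ->
  (forall n, half_trajectory (u n)) -> u n 0 @[n --> \oo] --> x0 ->
  exists s f, [/\ {homo s : i j / (i < j)%N}, half_trajectory f &
    forall a e : R, 0 < e -> exists N, forall n, (N <= n)%N ->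
      forall t : R, 0 <= t -> t <= a -> mdist (f t) (u (s n) t) < e].
Proof.
move=> K4 Ku ux0; have [||s [f [hs Kf]]] := K4 (fun n => sigL (Rplus R) (u n)) x0.
- exact: Ku.
- by under eq_cvg do rewrite sigL_val val_to_Rplus//.
move=> /fam_cvgP uf; exists s, (f \o @to_Rplus R); split => //.
  by rewrite /half_trajectory sigL_to_Rplus.
move=> a e e0; pose A := @to_Rplus R @` `[0, a].
have /uf : compact A.
  apply: continuous_compact; last exact: segment_compact.
  by apply: continuous_subspaceT; exact: to_Rplus_continuous.
move=> /(_ [set h | forall y, A y -> ball (f y) e (h y)]) [].
  apply/uniform_nbhs; exists [set xy | ball xy.1 e xy.2]; split => //.
  exact: entourage_ball (PosNum e0).
move=> N _ NP; exists N => n Nn t t0 ta.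
have At : A (to_Rplus t) by exists t => //=; rewrite in_itv/= t0.
by have := NP n Nn _ At; rewrite ballEmdist sigL_val val_to_Rplus.
Qed.

Hypothesis Kcont : forall f : Rplus R -> X, K f -> continuous f.

Lemma to_Rplus_comp_continuous (f : Rplus R -> X) : K f -> continuous (f \o @to_Rplus R).
Proof.
move=> Kf x; apply: continuous_comp; first exact: to_Rplus_continuous.
exact: Kcont.
Qed.

Lemma complete_trajectory_continuous g : complete_trajectory K g -> continuous g.
Proof.
(* Starting the restriction at [t - 1] makes [t] interior to its domain, so continuity on the
   half-line gives two-sided continuity at [t]. *)
move=> gK t; pose F := sigL (Rplus R) (fun r => g (r + (t - 1))).
have Fc : continuous ((F \o @to_Rplus R) \o (fun r => r - (t - 1))).
  move=> x; apply: continuous_comp; last first.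
    exact: (to_Rplus_comp_continuous (gK (t - 1))).
  by apply: cvgB; [exact: cvg_id | exact: cvg_cst].
have gF r : t - 1 <= r -> g r = ((F \o @to_Rplus R) \o (fun r => r - (t - 1))) r.
  by move=> tr; rewrite /F /comp sigL_val val_to_Rplus ?subr_ge0// subrK.
rewrite /continuous_at gF; last by lra.
apply: cvg_trans (Fc t); apply: near_eq_cvg.
near=> r; rewrite -gF// ltW//; near: r; apply: lt_nbhsr; lra.
Unshelve. all: by end_near. Qed.

End HalfTrajectories.

(** Each [S k.+1] refines [S k] so as to achieve [Q k]; the diagonal [S n n] is eventually a
    subsequence of every [S k], which the second hypothesis on [Q] tolerates. *)
Lemma diagonal_subsequence (Q : nat -> (nat -> nat) -> Prop) :
  (forall k s, {homo s : i j / (i < j)%N} ->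
    exists r, {homo r : i j / (i < j)%N} /\ Q k (s \o r)) ->
  (forall k s s', Q k s ->
    (exists N, forall n, (N <= n)%N -> exists2 m, (n <= m)%N & s' n = s m) -> Q k s') ->
  exists s, {homo s : i j / (i < j)%N} /\ forall k, Q k s.
Proof.
move=> Qsub Qext.
have /choice[r rP] : forall ks : nat * (nat -> nat), exists r,
    {homo ks.2 : i j / (i < j)%N} ->
    {homo r : i j / (i < j)%N} /\ Q ks.1 (ks.2 \o r).
  move=> [k s]; have [hs|hs] := pselect {homo s : i j / (i < j)%N}.
    by have [r rP] := Qsub k s hs; exists r.
  (* Default value for a sequence that is not increasing; it never occurs among the [S k]. *)
  by exists id.
pose S := fix S k := if k is k'.+1 then S k' \o r (k', S k') else id.
have hS k : {homo S k : i j / (i < j)%N}.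
  elim: k => [//|k IH] i j ij; apply: (IH) => /=.
  by have [+ _] := rP (k, S k) IH; apply.
have hr k : {homo r (k, S k) : i j / (i < j)%N}.
  by have [] := rP (k, S k) (hS k).
have QS k : Q k (S k.+1) by have [] := rP (k, S k) (hS k).
have S_sub k d n : exists2 m, (n <= m)%N & S (k + d)%N n = S k m.
  elim: d n => [|d IH] n; first by exists n => //; rewrite addn0.
  rewrite addnS /=; have [m nm ->] := IH (r ((k + d)%N, S (k + d)%N) n).
  by exists m => //; apply: leq_trans nm; exact: homo_geq_id.
exists (fun n => S n n); split=> [|k].
  apply: homo_ltn; first exact: ltn_trans.
  by move=> n /=; apply: hS; exact: (homo_geq_id (@hr n) n.+1).
apply: Qext (QS k) _; exists k.+1 => n kn.
by have := S_sub k.+1 (n - k.+1)%N n; rewrite subnKC.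
Qed.

(** * Omega- and alpha-limit sets *)

Section LimitSets.
Context {R : realType} {X : metricType R}.
Implicit Types (g : R -> X) (y : X).

Lemma truncn_norm_gt (t : R) : `|t| < (Num.truncn `|t|).+1%:R.
Proof. exact: Num.Theory.truncnS_gt. Qed.

Lemma mdist_lt_eq (x y : X) : (forall e : R, 0 < e -> mdist x y < e) -> x = y.
Proof.
move=> h; apply/eqP; apply: contrapT => /negP; rewrite -mdist_gt0 => /h.
by rewrite ltxx.
Qed.

Lemma omegaP g y : omega g y <->
  forall T e : R, 0 < e -> exists2 t, T <= t & mdist y (g t) < e.
Proof.
split=> [[t [/cvgryPge tT /cvg_mdistP gy]] T e e0|h].
  have [N _ NP] := tT T; have [N' N'P] := gy e e0.
  exists (t (maxn N N')); last by apply: N'P; exact: leq_maxr.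
  by apply: NP => /=; exact: leq_maxl.
have /choice[t tP] : forall n : nat, exists t, n%:R <= t /\ mdist y (g t) < n.+1%:R^-1.
  by move=> n; have [|t nt gt] := h n%:R n.+1%:R^-1; [rewrite invr_gt0 ltr0n | exists t].
exists t; split.
  apply/cvgryPge => T; exists (Num.truncn `|T|).+1 => // n /= Tn.
  have [nt _] := tP n; rewrite (le_trans (ler_norm _))//.
  rewrite (le_trans (ltW (truncn_norm_gt _)))// (le_trans _ nt)//.
  by rewrite ler_nat.
apply/cvg_mdistP => e /invS_lt[N NP]; exists N => n /NP.
by apply: lt_trans; have [] := tP n.
Qed.

(** Time reversal transfers facts on omega-limit sets to alpha-limit sets. *)
Lemma alpha_omega g : alpha g = omega (g \o -%R).
Proof.
apply/seteqP; split=> y [t [tT gy]]; exists (fun n => - t n); split.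
- by apply/cvgNrNy; under eq_cvg do rewrite /= opprK.
- by under eq_cvg do rewrite /= opprK.
- by apply/cvgNry; under eq_cvg do rewrite /= opprK.
- exact: gy.
Qed.

Lemma alphaP g y : alpha g y <->
  forall T e : R, 0 < e -> exists2 t, t <= T & mdist y (g t) < e.
Proof.
rewrite alpha_omega; apply: (iff_trans (omegaP _ _)); split=> h T e e0.
  by have [t Tt yt] := h (- T) e e0; exists (- t) => //; lra.
by have [t Tt yt] := h (- T) e e0; exists (- t); [lra | rewrite /= opprK].
Qed.

Lemma omega_Rplus_omega (f : Rplus R -> X) : omega_Rplus f = omega (f \o @to_Rplus R).
Proof.
apply/seteqP; split=> y.
  move=> [t [tT fy]]; exists (fun n => \val (t n)); split=> //.
  by under eq_cvg do rewrite /comp to_RplusK.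
move=> /omegaP h.
(* With absolute values every time of the sequence is nonnegative, not only the late ones, so
   [to_Rplus] never truncates. *)
have [t [tT fy]] : omega (fun t => f (to_Rplus `|t|)) y.
  apply/omegaP => T e e0; have [t] := h (Num.max 0 T) e e0.
  rewrite ge_max => /andP[t0 Tt] yt; exists t => //.
  by rewrite ger0_norm.
exists (fun n => to_Rplus `|t n|); split=> //.
move/cvgryPge: tT => tT; apply/cvgryPge => T; apply: filterS (tT T) => n Tt.
by rewrite val_to_Rplus// (le_trans Tt)// ler_norm.
Qed.

Lemma compact_omega (C : set X) g (t : nat -> R) : compact C ->
  (forall n, C (g (t n))) -> (forall n, n%:R <= t n) ->
  exists s y, [/\ {homo s : i j / (i < j)%N}, omega g y &
    g (t (s n)) @[n --> \oo] --> y].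
Proof.
move=> cC Cg tn; have [s [y [hs _ gy]]] := compact_subseq cC Cg.
exists s, y; split => //; exists (t \o s); split => //.
apply/cvgryPge => T; exists (Num.truncn `|T|).+1 => // n /= Tn.
rewrite (le_trans (ler_norm _))// (le_trans (ltW (truncn_norm_gt _)))//.
rewrite (le_trans _ (tn _))// ler_nat (leq_trans Tn)//; exact: homo_geq_id.
Qed.

Lemma omega_nonempty (C : set X) g (T : R) : compact C ->
  (forall t, T <= t -> C (g t)) -> omega g !=set0.
Proof.
move=> cC Cg; have [n|n|s [y [_ gy _]]] := @compact_omega C g (fun n => `|T| + n%:R) cC.
- by apply: Cg; have := ler_norm T; have : 0 <= n%:R :> R by []; lra.
- by have := normr_ge0 T; lra.
- by exists y.
Qed.

End LimitSets.

(** * Limits and concatenation of complete trajectories *)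

Section CompleteTrajectories.
Context {R : realType} {X : metricType R} (K : set (Rplus R -> X)).
Hypotheses (K2 : condK2 K) (K3 : condK3 K) (K4 : condK4 K).
Implicit Types (g : R -> X) (C : set X).

(** For each [k], (K4) applied from time [-k], where the initial values lie in the compact [C],
    gives a limit on [[-k, oo)]; a diagonal subsequence serves all [k], and the limits agree where
    they overlap. *)
Lemma complete_trajectory_limit C (u : nat -> R -> X) : compact C ->
  (forall k : nat, exists N, forall n, (N <= n)%N ->
    half_trajectory K (fun t => u n (t - k%:R)) /\ C (u n (- k%:R))) ->
  exists s g, [/\ {homo s : i j / (i < j)%N}, complete_trajectory K g &
    forall a e : R, 0 < e -> exists N, forall n, (N <= n)%N ->
      forall t, `|t| <= a -> mdist (g t) (u (s n) t) < e].
Proof.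
move=> cC uP.
pose Q (k : nat) s := exists g, half_trajectory K (fun t => g (t - k%:R)) /\
  forall a e : R, 0 < e -> exists N, forall n, (N <= n)%N ->
    forall t, - k%:R <= t -> t <= a -> mdist (g t) (u (s n) t) < e.
have [k s hs|k s s' [g [Kg gs]] [N NP]|s [hs /choice[g_ g_P]]] :=
    @diagonal_subsequence Q.
- have [N NP] := uP k.
  (* Shifting the indices by [N] makes the hypothesis for [k] available for every term. *)
  have le_N n : (N <= s (n + N))%N.
    by rewrite (leq_trans _ (homo_geq_id hs _))// leq_addl.
  have [n|r1 [x0 [hr1 _ r1x0]]] :=
    @compact_subseq R X C (fun n => u (s (n + N)%N) (- k%:R)) cC.
    by have [] := NP _ (le_N n).
  have [n||r2 [f [hr2 Kf fP]]] := @half_trajectory_limit R X K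
      (fun n t => u (s (r1 n + N)%N) (t - k%:R)) x0 K4.
  + by have [] := NP _ (le_N (r1 n)).
  + by under eq_cvg do rewrite sub0r.
  exists (fun n => (r1 (r2 n) + N)%N); split.
    by move=> i j ij; rewrite ltn_add2r; apply: hr1; exact: hr2.
  exists (fun t => f (t + k%:R)); split.
    by apply: half_trajectory_ext Kf => t _; rewrite subrK.
  move=> a e e0; have [N' N'P] := fP (a + k%:R) e e0.
  exists N' => n /N'P {}N'P t kt ta; have := N'P (t + k%:R).
  by rewrite addrK; apply; lra.
- exists g; split => // a e e0; have [N' N'P] := gs a e e0.
  exists (maxn N N') => n; rewrite geq_max => /andP[/NP[m nm ->] N'n].
  by apply: N'P; exact: leq_trans nm.
(* The value at [t] is read from a window that is large enough to contain [t]. *)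
pose g t := g_ (Num.truncn `|t|).+1 t.
have gE k t : - k%:R <= t -> g_ k t = g t.
  move=> kt; apply: mdist_lt_eq => e e0; have e20 : 0 < e / 2 by lra.
  have [_ /(_ t _ e20)[N NP]] := g_P k.
  have [_ /(_ t _ e20)[N' N'P]] := g_P (Num.truncn `|t|).+1.
  have := NP _ (leq_maxl N N') t kt (lexx _).
  have := N'P _ (leq_maxr N N') t _ (lexx _).
  rewrite -/(g t); set x := u _ _ => /(_ _) gx g_x.
  rewrite (le_lt_trans (metric_triangle _ x _))// [e]splitr ltrD//.
  rewrite metric_sym; apply: gx.
  by rewrite lerNl (le_trans _ (ltW (truncn_norm_gt _)))// -normrN ler_norm.
exists s, g; split => //.
(* The restriction from time [h] is the limit on the window from [-k], moved forward by [h + k] with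
   (K2). *)
- move=> h; pose k := (Num.truncn `|h|).+1.
  have hk : 0 <= h + k%:R.
    by have := truncn_norm_gt h; rewrite -/k; have := ler_norm (- h); rewrite normrN; lra.
  have [Kg _] := g_P k; apply: half_trajectory_ext (half_trajectory_shift K2 hk Kg).
  by move=> t t0; rewrite addrA addrK gE//; lra.
- move=> a e e0; pose k := (Num.truncn `|a|).+1.
  have [_ /(_ a e e0)[N NP]] := g_P k; exists N => n Nn t.
  rewrite ler_norml => /andP[at_ ta].
  have kt : - k%:R <= t.
    by have := truncn_norm_gt a; rewrite -/k; have := ler_norm a; lra.
  by rewrite -(gE k)//; exact: NP.
Qed.

Lemma complete_trajectory_shift g (h : R) :
  complete_trajectory K g -> complete_trajectory K (fun t => g (t + h)).
Proof.
move=> Kg a; apply: half_trajectory_ext (Kg (a + h)) => t _.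
by rewrite addrA.
Qed.

(** From a start [h] at least 0 only [g2] is seen; from a negative [h], (K3) joins the two pieces at
    time [- h]. *)
Lemma complete_trajectory_concat g1 g2 : g1 0 = g2 0 ->
  complete_trajectory K g1 -> complete_trajectory K g2 ->
  complete_trajectory K (fun t => if t <= 0 then g1 t else g2 t).
Proof.
move=> g12 Kg1 Kg2 h; have [h0|h0] := leP 0 h.
  apply: half_trajectory_ext (Kg2 h) => t t0 /=.
  by case: ifPn => // th; have -> : t + h = 0 by lra.
have := @half_trajectory_concat R X K _ _ (- h) K3 _ _ (Kg1 h) (Kg2 0).
rewrite addr0 addNr => /(_ _ (esym g12)) H.
apply: half_trajectory_ext (H _) => [t t0 /=|]; last by rewrite oppr_gt0.
have -> : (t + h <= 0) = (t <= - h) by apply/idP/idP; lra.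
by rewrite addr0 opprK.
Qed.

(** If [g (t n)] tends to [y] with [t n] at most [-n], the translates of [g] by [t n] subconverge to
    a complete trajectory through [y], all of whose values are again limits of [g] at times going to
    minus infinity. *)
Lemma alpha_quasi_invariant C g (T : R) : compact C -> complete_trajectory K g ->
  (forall t, t <= T -> C (g t)) -> quasi_invariant K (alpha g).
Proof.
move=> cC Kg Cg y /alphaP gy.
have /choice[t tP] : forall n : nat,
    exists t, t <= - n%:R /\ mdist y (g t) < n.+1%:R^-1.
  move=> n; have [|t nt gt] := gy (- n%:R) n.+1%:R^-1; last by exists t.
  by rewrite invr_gt0 ltr0n.
have [k|s [G [hs KG GP]]] := @complete_trajectory_limit C (fun n r => g (t n + r)) cC.
  exists (Num.truncn `|T|).+1 => n Tn; split.
    apply: half_trajectory_ext (Kg (t n - k%:R)) => r _.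
    by congr g; lra.
  apply: Cg; have [tn _] := tP n; have := truncn_norm_gt T.
  have := ler_norm (- T); rewrite normrN.
  have : (Num.truncn `|T|).+1%:R <= n%:R :> R by rewrite ler_nat.
  have : 0 <= k%:R :> R by [].
  lra.
exists G; split => //.
  apply: mdist_lt_eq => e e0; have e20 : 0 < e / 2 by lra.
  have [N NP] := GP 0 _ e20; have [N' N'P] := invS_lt e20.
  have := NP _ (leq_maxl N N') 0; rewrite normr0 addr0 => /(_ (lexx _)) Gt.
  have [_ yt] := tP (s (maxn N N')).
  have := N'P _ (leq_trans (leq_maxr N N') (homo_geq_id hs _)) => /(lt_trans yt) {}yt.
  rewrite (le_lt_trans (metric_triangle _ (g (t (s (maxn N N')))) _))//.
  by rewrite [e]splitr ltrD// metric_sym.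
move=> r; apply/alphaP => T' e e0; have [N NP] := GP `|r| e e0.
pose n := maxn N (Num.truncn `|r - T'|).+1.
exists (t (s n) + r); last by apply: NP => //; exact: leq_maxl.
have [+ _] := tP (s n); have := truncn_norm_gt (r - T').
have : (Num.truncn `|r - T'|).+1%:R <= (s n)%:R :> R.
  by rewrite ler_nat (leq_trans _ (homo_geq_id hs _))// leq_maxr.
have := ler_norm (r - T'); lra.
Qed.

End CompleteTrajectories.

(** * Connections *)

Section OmegaCrossing.
Context {R : realType} {X : metricType R}.
Implicit Types (f g : R -> X) (A C : set X).

Lemma omega_crossing g A x y (e : R) : continuous g -> A !=set0 ->
  omega g y -> omega g x -> dist_to A y < e -> e < dist_to A x ->
  forall T d : R, 0 < d -> exists t s, [/\ T <= t, t <= s, mdist y (g t) < d,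
    dist_to A (g s) = e & forall r, t <= r -> r <= s -> dist_to A (g r) <= e].
Proof.
move=> cg A0 /omegaP gy /omegaP gx ye ex T d d0.
(* The second bound keeps [g t] below level [e], since the distance to [A] is 1-Lipschitz. *)
have [|t Tt] := gy T (Num.min d (e - dist_to A y)); first by rewrite lt_min d0 subr_gt0.
rewrite lt_min => /andP[ytd yte].
have [|s ts xs] := gx t (dist_to A x - e); first by rewrite subr_gt0.
have ct : continuous (dist_to A \o g).
  by move=> r; apply: continuous_comp; [exact: cg | exact: dist_to_continuous].
have [||c [tc cs ce cP]] := first_crossing ct ts (e := e).
- by have := dist_to_triangle (g t) y A0; rewrite metric_sym /=; lra.
- by have := dist_to_triangle x (g s) A0; rewrite /=; lra.
by exists t, c.
Qed.

(** The orbit crosses level [e] at arbitrarily late times, and by compactness the crossing points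
    accumulate. *)
Lemma omega_dist_to_eq C g A x y (e : R) : compact C ->
  (forall t, 0 <= t -> C (g t)) -> continuous g -> A !=set0 ->
  omega g y -> omega g x -> dist_to A y < e -> e < dist_to A x ->
  exists2 z, omega g z & dist_to A z = e.
Proof.
move=> cC Cg cg A0 gy gx ye ex.
have /choice[t tP] : forall n : nat, exists t, n%:R <= t /\ dist_to A (g t) = e.
  move=> n; have [t [s [nt ts _ se _]]] :=
    omega_crossing cg A0 gy gx ye ex n%:R ltr01.
  by exists s; split => //; exact: le_trans ts.
have [n|n|s [z [_ gz tz]]] := @compact_omega R X C g t cC.
- by have [nt _] := tP n; apply: Cg; apply: le_trans nt.
- by have [] := tP n.
exists z => //; apply: (cvg_dist_to_eq A0 tz) => n.
by have [] := tP (s n).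
Qed.

Lemma omega_subset_eventually f g (T : R) :
  (forall t, T <= t -> f t = g t) -> omega f `<=` omega g.
Proof.
move=> fg y /omegaP fy; apply/omegaP => S e e0.
have [t] := fy (Num.max T S) e e0; rewrite ge_max => /andP[Tt St].
by rewrite fg//; exists t.
Qed.

Lemma alpha_subset_eventually f g (T : R) :
  (forall t, t <= T -> f t = g t) -> alpha f `<=` alpha g.
Proof.
move=> fg; rewrite !alpha_omega; apply: (@omega_subset_eventually _ _ (- T)) => t Tt /=.
by apply: fg; lra.
Qed.

Lemma omega_subset_compact C g : compact C ->
  (forall t, 0 <= t -> C (g t)) -> omega g `<=` C.
Proof.
move=> cC Cg y /omegaP gy; have [t0 t0_ge0 _] := gy 0 1 ltr01.
have C0 : C !=set0 by exists (g t0); exact: Cg.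
apply: dist_to_eq0 => //; apply/eqP; rewrite eq_le dist_to_ge0// andbT.
apply/ler_addgt0Pl => e e0; have [t t_ge0 yt] := gy 0 e e0.
by rewrite addr0 (le_trans (dist_to_le _ (Cg t t_ge0)))// ltW.
Qed.

End OmegaCrossing.

(** * Connections out of an isolated set *)

Section Chains.
Context {R : realType} {X : metricType R} (K : set (Rplus R -> X)).
Hypotheses (Kcont : forall f, K f -> continuous f).
Hypotheses (K2 : condK2 K) (K3 : condK3 K) (K4 : condK4 K).
Implicit Types (g : R -> X) (A C O : set X).

(** The alpha-limit set is quasi-invariant and stays within [e] of [A], hence in [O], where
    maximality of [A] applies. *)
Lemma isolated_alpha A C O g (T e : R) : A !=set0 -> compact C ->
  (forall B, quasi_invariant K B -> B `<=` O -> B `<=` A) ->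
  (forall x, dist_to A x <= e -> O x) -> complete_trajectory K g ->
  (forall t, t <= T -> C (g t)) -> (forall t, t <= T -> dist_to A (g t) <= e) ->
  alpha g !=set0 /\ alpha g `<=` A.
Proof.
move=> A0 cC maxA eO Kg Cg ge; split.
  rewrite alpha_omega; apply: (@omega_nonempty _ _ C _ (- T)) => // t Tt /=.
  by apply: Cg; lra.
apply: maxA (alpha_quasi_invariant K2 K4 cC Kg Cg) _ => y /alphaP gy.
apply: eO; apply/ler_addgt0Pl => d d0; have [t tT yt] := gy T d d0.
rewrite (le_trans (dist_to_triangle _ (g t) A0))// lerD// ?ge// ltW//.
Qed.

(* The limit [g] of the orbit seen from its exit times may enter [A] in the past,
   since trajectories are not unique; its past is then replaced by a complete
   trajectory inside [A]. *)
Lemma exit_trajectory A C (p : R -> X) (e : R) : compact A -> A !=set0 ->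
  quasi_invariant K A -> compact C -> (forall t, 0 <= t -> C (p t)) ->
  continuous p -> half_trajectory K p -> A `<=` omega p -> 0 < e ->
  (exists2 x, omega p x & e < dist_to A x) ->
  exists g T, [/\ complete_trajectory K g, forall t, omega p (g t),
    dist_to A (g 0) = e & forall t, t <= T -> dist_to A (g t) <= e].
Proof.
move=> cA A0 Aqi cC Cp cp Kp Ap e0 [x px ex].
have [y Ay] := A0; have ye : dist_to A y < e by rewrite dist_to0.
(* [ts n] pairs a late time very close to [A] with the next time at level [e]; the orbit stays
   within [e] of [A] in between. *)
have /choice[ts tsP] : forall n : nat, exists ts : R * R,
    [/\ n%:R <= ts.1, ts.1 <= ts.2, dist_to A (p ts.1) < n.+1%:R^-1,
    dist_to A (p ts.2) = e &
    forall r, ts.1 <= r -> r <= ts.2 -> dist_to A (p r) <= e].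
  move=> n; have [|t [s [nt tles yt se tsr]]] :=
    omega_crossing cp A0 (Ap y Ay) px ye ex n%:R (d := n.+1%:R^-1).
    by rewrite invr_gt0 ltr0n.
  exists (t, s); split => //=; apply: le_lt_trans yt.
  by rewrite metric_sym; exact: dist_to_le.
have ns n : n%:R <= (ts n).2 by have [nt ? _ _ _] := tsP n; exact: le_trans nt _.
have [k|s [g [hs Kg gP]]] :=
    @complete_trajectory_limit R X K K2 K4 C (fun n r => p ((ts n).2 + r)) cC.
  exists k => n kn.
  have ks : 0 <= (ts n).2 - k%:R by rewrite subr_ge0 (le_trans _ (ns n))// ler_nat.
  split; last exact: Cp.
  apply: half_trajectory_ext (half_trajectory_shift K2 ks Kp) => t _.
  by congr p; lra.
have pg t : omega p (g t).
  apply/omegaP => T d d0; have [N NP] := gP `|t| d d0.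
  pose n := maxn N (Num.truncn `|T - t|).+1.
  exists ((ts (s n)).2 + t); last by apply: NP => //; exact: leq_maxl.
  have := ns (s n); have := truncn_norm_gt (T - t); have := ler_norm (T - t).
  have : (Num.truncn `|T - t|).+1%:R <= (s n)%:R :> R.
    by rewrite ler_nat (leq_trans _ (homo_geq_id hs _))// leq_maxr.
  lra.
have g0e : dist_to A (g 0) = e.
  apply: (@cvg_dist_to_eq _ _ A (fun n => p (ts (s n)).2)) => //.
    apply/cvg_mdistP => d d0; have [N NP] := gP 0 d d0.
    by exists N => n /NP /(_ 0); rewrite normr0 addr0 => /(_ (lexx _)).
  by move=> n; have [] := tsP (s n).
have [[a [a0 Aga]]|past] := pselect (exists a, 0 <= a /\ A (g (- a))).
  have [q [Kq q0 Aq]] := Aqi _ Aga.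
  pose h t := if t <= 0 then q t else g (t - a).
  have Kh : complete_trajectory K h.
    apply: complete_trajectory_concat => //; last exact: complete_trajectory_shift.
    by rewrite q0 sub0r.
  exists (fun t => h (t + a)), (- a); split.
  - exact: complete_trajectory_shift.
  - by move=> t; rewrite /h; case: ifP => _ //; apply: Ap; exact: Aq.
  - rewrite /h add0r; case: ifPn => [a_le0|]; last by rewrite subrr.
    (* If the junction fell at time 0, then [g 0] would lie in [A], against its distance [e > 0]. *)
    have a_eq0 : a = 0 by lra.
    by move: Aga e0; rewrite -g0e a_eq0 oppr0 => /dist_to0 ->; rewrite ltxx.
  - move=> t ta; rewrite /h ifT; last by lra.
    by rewrite dist_to0 ?ltW.
(* When [g] avoids [A] in the past, [T = 0] works: an excess over [e] at some [t <= 0] will force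
   the approach to [A] into the window [[t, 0]], where [g] keeps a distance at least [eta > 0]. *)
exists g, 0; split => // t t0; rewrite leNgt; apply/negP => et.
have cg : continuous (dist_to A \o g).
  move=> r; apply: continuous_comp; last exact: dist_to_continuous.
  exact: complete_trajectory_continuous Kcont _ Kg r.
have [r rt0 rmin] := EVT_min t0 (continuous_subspaceT cg).
set eta := dist_to A (g r) in rmin *.
have eta0 : 0 < eta.
  rewrite lt_neqAle dist_to_ge0// andbT; apply/eqP => /esym /(dist_to_eq0 cA A0) Agr.
  apply: past; exists (- r); rewrite opprK; split => //.
  by move: rt0; rewrite in_itv/= => /andP[_]; lra.
(* The first bound keeps the nearby orbit above [e] at time [t]; the second leaves half of [eta] for
   its distance to [A] at the approach time. *)
pose d := Num.min (dist_to A (g t) - e) (eta / 2).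
have d0 : 0 < d by rewrite lt_min subr_gt0 et/=; lra.
have [N NP] := gP `|t| d d0.
have [N' N'P] : exists N, forall n, (N <= n)%N -> n.+1%:R^-1 < eta / 2.
  by apply: invS_lt; lra.
pose n := maxn N N'; have [_ tles tA sA tsr] := tsP (s n).
have t_inv := N'P _ (leq_trans (leq_maxr N N') (homo_geq_id hs _)).
have close v : `|v| <= `|t| ->
    dist_to A (g v) < d + dist_to A (p ((ts (s n)).2 + v)).
  move=> vt; rewrite (le_lt_trans (dist_to_triangle _ (p ((ts (s n)).2 + v)) A0))//.
  by rewrite ltrD2r; apply: NP => //; exact: leq_maxl.
have dle1 : d <= dist_to A (g t) - e by rewrite ge_min lexx.
have dle2 : d <= eta / 2 by rewrite ge_min lexx orbT.
(* Above level [e], the orbit cannot be between approach and exit, so it has not yet made its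
   approach. *)
have exit_t : (ts (s n)).2 + t < (ts (s n)).1.
  rewrite ltNge; apply/negP => h.
  have := tsr _ h; have := close t (lexx _) => ? /(_ _); lra.
pose v := (ts (s n)).1 - (ts (s n)).2.
have vt : `|v| <= `|t| by rewrite !ler0_norm//; rewrite /v; lra.
have gv : eta <= dist_to A (g v).
  by apply: rmin; rewrite in_itv/= /v; apply/andP; split; lra.
have := close v vt; rewrite (_ : _ + v = (ts (s n)).1); last by rewrite /v addrC subrK.
have := lt_trans tA t_inv; lra.
Qed.


Lemma connection_from (m : nat) (M : 'I_m -> set X) (C W : set X) (e : 'I_m -> R)
    (p : R -> X) (KK : set (R -> X)) (j : 'I_m) :
  compact C -> (forall t, 0 <= t -> C (p t)) -> continuous p ->
  half_trajectory K p -> W = omega p ->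
  (forall g, KK g -> complete_trajectory K g) ->
  W = [set g 0 | g in KK] -> (forall g, KK g -> range g `<=` W) ->
  \bigcup_(g in KK) omega g `<=` \bigcup_i M i ->
  (forall i, M i `<=` W) -> (forall i, M i !=set0) -> (forall i, compact (M i)) ->
  (forall i, quasi_invariant K (M i)) ->
  (forall i, 0 < e i) ->
  (forall i l x, l != i -> M l x -> e i < dist_to (M i) x) ->
  (exists O, (forall B, quasi_invariant K B -> B `<=` O -> B `<=` M j) /\
    forall x, dist_to (M j) x <= e j -> O x) ->
  (exists2 x, W x & e j < dist_to (M j) x) ->
  exists l g, connecting_trajectory K (M j) (M l) g /\ range g `<=` W.
Proof.
move=> cC Cp cp Kp WE KKc W0 KKW OmM MW M0 cM Mqi e0 sepM [V [maxM eV]] [x Wx ex].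
have WC : W `<=` C by rewrite WE; exact: omega_subset_compact.
(* A point at level [e i] is too far from [M i] to belong to it and too close to belong to another
   set of the family. *)
have not_M y i l : dist_to (M i) y = e i -> ~ M l y.
  move=> yi; have [->|li] := eqVneq l i => Mly.
    by have := e0 i; rewrite -yi dist_to0// ltxx.
  by have := sepM _ _ _ li Mly; rewrite yi ltxx.
have [||g [T [Kg Wg g0e gT]]] := @exit_trajectory (M j) C p (e j) (cM j) (M0 j) (Mqi j)
    cC Cp cp Kp _ (e0 j).
- by rewrite -WE.
- by rewrite -WE; exists x.
rewrite -WE in Wg.
have [g_alpha0 g_alpha] : alpha g !=set0 /\ alpha g `<=` M j.
  apply: (isolated_alpha (M0 j) cC maxM eV Kg _ gT) => t _.
  exact: WC.
(* Since [g 0] lies in [W], some [h] in [KK] starts there and can take over the future. *)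
have [h KKh h0] : [set g 0 | g in KK] (g 0) by rewrite -W0.
have hC t : 0 <= t -> C (h t) by move=> _; apply/WC/(KKW _ KKh); exists t.
have [y hy] := omega_nonempty cC hC.
have [l _ Mly] : (\bigcup_i M i) y by apply: OmM; exists h.
have hl : omega h `<=` M l.
  move=> z hz; have [i _ Miz] : (\bigcup_i M i) z by apply: OmM; exists h.
  have [<-//|il] := eqVneq i l.
  have [|w hw we] := omega_dist_to_eq cC hC
    (complete_trajectory_continuous Kcont (KKc _ KKh)) (M0 l) hy hz _ (sepM _ _ _ il Miz).
    by rewrite dist_to0.
  have [k _ Mkw] : (\bigcup_i M i) w by apply: OmM; exists h.
  by have := not_M _ _ k we.
pose c t := if t <= 0 then g t else h t.
have cW t : W (c t).
  by rewrite /c; case: ifP => _; [exact: Wg | apply: (KKW _ KKh); exists t].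
have ch t : 1 <= t -> c t = h t by move=> t1; rewrite /c leNgt (lt_le_trans ltr01 t1).
have cg t : t <= 0 -> c t = g t by move=> t0; rewrite /c t0.
exists l, c; split; last by move=> _ [t _ <-].
split.
- split; first by apply: complete_trajectory_concat => //; exact: KKc.
  have [B BP] := compact_mbounded cC; exists B => _ _ [t _ <-] [t' _ <-].
  by apply: BP; exact: WC.
- by rewrite cg// => -[|]; exact: not_M g0e.
- split; last by apply: subset_trans hl; exact: omega_subset_eventually ch.
  by exists y; apply: omega_subset_eventually hy => t /ch.
- split; last by apply: subset_trans g_alpha; exact: alpha_subset_eventually cg.
  by have [z gz] := g_alpha0; exists z; apply: alpha_subset_eventually gz => t /cg.
Qed.

End Chains.

(** * Finite cycles, separation and construction of the chain *)

(** Among [m + 1] iterates two coincide, which yields a periodic point [y]; taking its least period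
    [k] makes the first [k] iterates distinct. *)
Lemma iter_cycle (m : nat) (f : 'I_m -> 'I_m) (x : 'I_m) : exists y k,
  [/\ (0 < k <= m)%N, iter k f y = y &
  forall i j : 'I_k, iter i f y = iter j f y -> i = j].
Proof.
have [i [j [ij fij]]] : exists i j, (i < j)%N /\ iter i f x = iter j f x.
  apply: contrapT => h; have inj : injective (fun i : 'I_m.+1 => iter i f x).
    move=> i j fij; apply: val_inj => /=; apply: contrapT => /eqP.
    by rewrite neq_ltn => /orP[ij|ji]; apply: h; [exists i, j | exists j, i].
  by have := leq_card _ inj; rewrite !card_ord ltnn.
have : exists k, (0 < k)%N && (iter k f (iter i f x) == iter i f x).
  by exists (j - i)%N; rewrite subn_gt0 ij -iterD subnK ?(ltnW ij)// fij eqxx.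
move: (iter i f x) => y P; have [k /andP[k0 /eqP ky] kmin] := ex_minnP P.
have inj (a b : 'I_k) : (a < b)%N -> iter a f y <> iter b f y.
  move=> ab E; have := kmin (k - b + a)%N.
  rewrite iterD E -iterD subnK ?(ltnW (ltn_ord b))// ky eqxx andbT.
  by have := ltn_ord b; lia.
have inj' : injective (fun i : 'I_k => iter i f y).
  move=> a b E; apply: val_inj => /=; apply: contrapT => /eqP.
  rewrite neq_ltn => /orP[/inj|/inj]; [exact | by apply].
exists y, k; split=> //; rewrite k0.
by have := leq_card _ inj'; rewrite !card_ord.
Qed.

(** Removing from [O] the other sets of the family and the point [x] leaves a neighbourhood of the
    compact [M i], which contains a uniform one. *)
Lemma separating_radius (R : realType) (X : metricType R) (m : nat)
    (M : 'I_m -> set X) (i : 'I_m) (O : set X) (x : X) :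
  (forall l, compact (M l)) -> M i !=set0 -> trivIset setT M -> set_nbhs (M i) O ->
  ~ M i x -> exists e, [/\ 0 < e, forall y, dist_to (M i) y <= e -> O y,
    forall l y, l != i -> M l y -> e < dist_to (M i) y & e < dist_to (M i) x].
Proof.
move=> cM M0 disjM MO Mx.
pose U := O `&` [set y | forall l, l != i -> ~ M l y] `&` ~` [set x].
have [a Ma|e e0 eU] := @compact_nbhs_dist_to _ _ (M i) U (cM i) M0.
  have cl A : compact A -> ~ A a -> nbhs a (~` A).
    move=> cA Aa; apply: open_nbhs_nbhs; split => //; apply: closed_openC.
    by apply: compact_closed => //; exact: metric_hausdorff.
  apply: filterI; last first.
    by apply: cl; [exact: compact_set1 | move=> /= ax; rewrite -ax in Mx].
  apply: filterI; first exact: MO.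
  apply: filter_forall => l; have [->|li] := eqVneq l i; first exact: nearW.
  have /cl : ~ M l a.
    by move=> Mla; move/eqP: li; apply; apply: disjM => //; exists a.
  by move=> /(_ (cM l)); apply: filterS.
exists e; split => //.
- by move=> y /eU[[]].
- move=> l y li Mly; rewrite ltNge; apply/negP => /eU[[_ /(_ l li)]].
  exact.
- by rewrite ltNge; apply/negP => /eU[_]; exact.
Qed.

Lemma trivIset_single (T : Type) (m : nat) (M : 'I_m -> set T) (j : 'I_m)
    (m_gt0 : (0 < m)%N) :
  (forall i, M i !=set0) -> trivIset setT M -> (forall i, M i `<=` M j) ->
  m = 1%N /\ j = Ordinal m_gt0.
Proof.
move=> M0 disjM Mj; have all_j i : i = j.
  by have [x Mx] := M0 i; apply: disjM => //; exists x; split => //; exact: (Mj i).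
split; last by rewrite -(all_j (Ordinal m_gt0)).
apply/eqP; rewrite eqn_leq m_gt0 andbT leqNgt; apply/negP => m1.
by have := congr1 val (etrans (all_j (Ordinal m_gt0)) (esym (all_j (Ordinal m1)))).
Qed.

Unset Implicit Arguments.

Theorem lemma20 (R : realType) (X : completeMetricType R)
  (K : set (Rplus R -> X))
  (Kcont : forall f, K f -> continuous f)
  (K1 : condK1 K) (K2 : condK2 K) (K3 : condK3 K) (K4 : condK4 K)
  (phi : Rplus R -> X) (Kphi : K phi)
  (cphi : compact (closure (range phi)))
  (KK : set (R -> X))
  (KK_traj : forall g, KK g -> bounded_complete_trajectory K g)
  (KK_omega : omega_Rplus phi = [set g 0 | g in KK])
  (KK_sub : forall g, KK g -> range g `<=` omega_Rplus phi)
  (m : nat) (m_gt0 : (0 < m)%N) (M : 'I_m -> set X)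
  (Omega_sub : \bigcup_(g in KK) omega g `<=` \bigcup_j M j)
  (M_sub : forall j, M j `<=` omega_Rplus phi)
  (M_neq0 : forall j, M j !=set0)
  (M_compact : forall j, compact (M j))
  (M_disj : trivIset setT M)
  (M_isolated : forall j, isolated_qi K (M j))
  (M_qi : forall j, quasi_invariant K (M j)) :
  (omega_Rplus phi = M (Ordinal m_gt0) /\ m = 1%N) \/
  exists (k : nat) (C : 'I_k -> set X),
    [/\ (1 <= k <= m)%N,
        forall i, exists j, C i = M j,
        cyclical_chain K C &
        forall i, exists g, connecting_trajectory K (C i) (C (ordS i)) g /\
          range g `<=` omega_Rplus phi].
Proof.
(* If one [M j] contains the whole limit set, it contains every [M i], and disjointness leaves a
   single set. *)
have [[j Wj]|Wn] := pselect (exists j, omega_Rplus phi `<=` M j).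
  left; have [||i|m1 j0] := @trivIset_single X m M j m_gt0 => //.
    exact: subset_trans (M_sub i) Wj.
  by split => //; rewrite -j0; apply/seteqP; split.
right; set W := omega_Rplus phi in KK_omega KK_sub M_sub Wn *.
have /choice[e eP] : forall j, exists e : R, [/\ 0 < e,
    exists O, (forall B, quasi_invariant K B -> B `<=` O -> B `<=` M j) /\
      forall x, dist_to (M j) x <= e -> O x,
    forall l x, l != j -> M l x -> e < dist_to (M j) x &
    exists2 x, W x & e < dist_to (M j) x].
  move=> j; have [V [MO _ _ maxM]] := M_isolated j.
  have [x [Wx Mx]] : exists x, W x /\ ~ M j x.
    apply: contrapT => h; apply: Wn; exists j => x Wx.
    by apply: contrapT => Mx; apply: h; exists x.
  have [e [e0 eO sepM ex]] := separating_radius M_compact (M_neq0 j) M_disj MO Mx.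
  by exists e; split => //; [exists V | exists x].
have cp : continuous (phi \o @to_Rplus R).
  exact (@to_Rplus_comp_continuous R X K Kcont phi Kphi).
have Kp : half_trajectory K (phi \o @to_Rplus R).
  by rewrite /half_trajectory sigL_to_Rplus.
have Cp t : 0 <= t -> closure (range phi) ((phi \o @to_Rplus R) t).
  by move=> _; apply: subset_closure; exists (to_Rplus t).
have /choice[next /choice[g gP]] : forall j, exists l g,
    connecting_trajectory K (M j) (M l) g /\ range g `<=` W.
  move=> j; apply: (@connection_from R X K Kcont K2 K3 K4 m M _ W e _ KK j
    cphi Cp cp Kp).
  - exact: omega_Rplus_omega.
  - by move=> h /KK_traj[].
  all: rewrite -?/W => //.
  - by move=> i; have [] := eP i.
  - by move=> i; have [_ _ + _] := eP i.
  - by have [] := eP j.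
  - by have [] := eP j.
have [y [k [k_le iter_k iter_inj]]] := iter_cycle next (Ordinal m_gt0).
(* At the last index [ordS] wraps to 0, and periodicity identifies iterate 0 with iterate [k]. *)
have iterS (i : 'I_k) : iter (ordS i) next y = next (iter i next y).
  transitivity (iter (i.+1 %% k) next y) => //.
  transitivity (iter i.+1 next y) => //; have := ltn_ord i.
  rewrite leq_eqVlt => /orP[/eqP ->|ik]; first by rewrite modnn iter_k.
  by rewrite modn_small.
exists k, (fun i => M (iter i next y)); split => //.
- by move=> i; exists (iter i next y).
- split=> [||i].
  + by case/andP: k_le.
  + by move=> i j _ _ /M_disj ij; apply: iter_inj; exact: ij.
  + by exists (g (iter i next y)); rewrite iterS; have [] := gP (iter i next y).
- by move=> i; exists (g (iter i next y)); rewrite iterS.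
Qed.
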